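(* No random online function $F:2^\omega\to 2^\omega$ is one-to-one.
   Context: $2^{<\omega}$ is the set of finite binary strings, $\epsilon$ the empty string, and $y\upharpoonright n=(y(0),\dots,y(n-1))$. Let $\sigma_0=\epsilon,\sigma_1,\sigma_2,\dots$ list $2^{<\omega}$ in length-lexicographic order. Each $x\in 2^\omega$ codes the representing function $f_x:2^{<\omega}\setminus\{\epsilon\}\to\{0,1\}$ given by $f_x(\sigma_{n+1})=x(n)$ for all $n$, and the online function $F_x:2^\omega\to 2^\omega$ given by $F_x(y)=f_x(y\upharpoonright 1)\,f_x(y\upharpoonright 2)\,f_x(y\upharpoonright 3)\cdots$, i.e. $F_x(y)(n)=f_x(y\upharpoonright (n+1))$. A function $F$ is a random online function if $F=F_x$ for some $x\in 2^\omega$ that is Martin-Löf random with respect to the uniform measure on $2^\omega$. *)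

(* Defs.v *)
From HB Require Import structures.
From mathcomp Require Import all_boot all_order all_algebra.
From mathcomp Require Import all_classical all_reals all_analysis.
From mathcomp Require Import measurable_realfun.
From mathcomp Require Import zify ring lra.

Set Implicit Arguments.
Unset Strict Implicit.
Unset Printing Implicit Defensive.

Import Order.TTheory GRing.Theory Num.Theory.

Local Open Scope classical_set_scope.

(* Binary strings are [seq bool], points of Cantor space are functions
   [nat -> bool], and [mkseq y n] is the initial segment of y of length n. *)

(* [incr] is the successor in bijective base 2 on strings read with the least
   significant bit first; reversing, it is the length-lexicographic successor. *)
Fixpoint incr (s : seq bool) : seq bool :=
  match s with
  | [::] => [:: false]
  | false :: s' => true :: s'
  | true :: s' => false :: incr s'
  end.

Definition sigma (n : nat) : seq bool := rev (iter n incr [::]).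

(* The position of a string in the list sigma; see [sigmaK] and [rankK]. *)
Definition rank (s : seq bool) : nat :=
  foldl (fun n (b : bool) => (n.*2 + b).+1)%N 0%N s.

Lemma rank_rcons s b : rank (rcons s b) = ((rank s).*2 + b).+1.
Proof. by rewrite /rank foldl_rcons. Qed.

Lemma rank_rev_incr s : rank (rev (incr s)) = (rank (rev s)).+1.
Proof.
elim: s => [|[] s IH] //=; rewrite !rev_cons !rank_rcons ?IH; lia.
Qed.

Lemma rankK : cancel sigma rank.
Proof. by elim=> [|n IH] //; rewrite /sigma iterS rank_rev_incr IH. Qed.

Lemma rank_inj : injective rank.
Proof.
elim/last_ind=> [|s b IH]; elim/last_ind=> [|t c _] //; rewrite ?rank_rcons //.
move=> h; have [/IH-> ->] // : rank s = rank t /\ b = c.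
by move: h; case: b; case: c => /=; lia.
Qed.

Lemma sigmaK : cancel rank sigma.
Proof. by move=> s; apply: rank_inj; rewrite rankK. Qed.

(* Value of a string as a binary numeral, most significant bit first. *)
Definition binval (s : seq bool) : nat :=
  foldl (fun n (b : bool) => n.*2 + b)%N 0%N s.

Lemma binval_rcons s b : binval (rcons s b) = ((binval s).*2 + b)%N.
Proof. by rewrite /binval foldl_rcons. Qed.

Lemma binval_lt s : (binval s < 2 ^ size s)%N.
Proof.
elim/last_ind: s => [|s b IH] //; rewrite binval_rcons size_rcons expnS; lia.
Qed.

Lemma binval_cons b s : binval (b :: s) = (b * 2 ^ size s + binval s)%N.
Proof.
elim/last_ind: s => [|s c IH]; first by rewrite /binval /=; lia.
rewrite -rcons_cons !binval_rcons IH size_rcons expnS; lia.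
Qed.

Lemma rank_binval s : rank s = (2 ^ size s + binval s).-1.
Proof.
elim/last_ind: s => [|s b IH] //.
rewrite rank_rcons binval_rcons size_rcons IH expnS.
have := expn_gt0 2 (size s); lia.
Qed.

Lemma ltn_rank (s t : seq bool) :
  (rank s < rank t)%N = (size s < size t)%N ||
    (size s == size t) && ((s : seqlexi bool) < t)%O.
Proof.
have := expn_gt0 2 (size s); have := expn_gt0 2 (size t).
rewrite !rank_binval; have := binval_lt s; have := binval_lt t.
case: (ltngtP (size s) (size t)) => [lt_st|lt_ts|e] /=.
- have h : (2 ^ (size s).+1 <= 2 ^ size t)%N by apply: leq_pexp2l.
  move: h; rewrite expnS; lia.
- have h : (2 ^ (size t).+1 <= 2 ^ size s)%N by apply: leq_pexp2l.
  move: h; rewrite expnS; lia.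
move=> _ _ _ _; rewrite e.
transitivity (binval s < binval t)%N.
  have := expn_gt0 2 (size t); lia.
elim: s t e => [|b s IH] [|c t] //= [e].
rewrite ltxi_cons !binval_cons e -(IH _ e).
have := binval_lt s; have := binval_lt t; rewrite e.
by case: b; case: c => /=; rewrite ?ltEbool ?leEbool /=; lia.
Qed.

(* f_x(sigma_{n+1}) = x(n); the value at the empty string is junk, and
   [online] never uses it. *)
Definition rep_fun (x : nat -> bool) (s : seq bool) : bool := x (rank s).-1.

Lemma rep_fun_sigma x n : rep_fun x (sigma n.+1) = x n.
Proof. by rewrite /rep_fun rankK. Qed.

Definition online (x : nat -> bool) (y : nat -> bool) : nat -> bool :=
  fun n => rep_fun x (mkseq y n.+1).

(* Partial recursive functions on nat, given by the arity-indexed terms of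
   Kleene's schemes. *)
Inductive recfun : nat -> Type :=
| Zero : recfun 0
| Succ : recfun 1
| Proj n : 'I_n -> recfun n
| Comp m n : recfun m -> ('I_m -> recfun n) -> recfun n
| PrimRec n : recfun n -> recfun n.+2 -> recfun n.+1
| Mu n : recfun n.+1 -> recfun n.

(* [graph f v y] means that the partial function f is defined at v, with value
   y.  Primitive recursion is on the first argument:
     h(0, v) = f(v),  h(k+1, v) = g(k, h(k, v), v),
   and the history of the recursion is the function t.  [Mu f] is the least y
   with f(y, v) = 0, all f(k, v) for k < y being defined. *)
Fixpoint graph n (f : recfun n) : n.-tuple nat -> nat -> Prop :=
  match f in recfun n return n.-tuple nat -> nat -> Prop with
  | Zero => fun _ y => y = 0%N
  | Succ => fun v y => y = (thead v).+1
  | Proj _ i => fun v y => y = tnth v i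
  | Comp m n f g => fun v y => exists2 w : m.-tuple nat,
      forall i, graph (g i) v (tnth w i) & graph f w y
  | PrimRec n f g => fun v y => exists t : nat -> nat,
      [/\ graph f [tuple of behead v] (t 0%N),
          forall k, (k < thead v)%N ->
            graph g [tuple of k :: t k :: [tuple of behead v]] (t k.+1)
        & y = t (thead v)]
  | Mu n f => fun v y =>
      graph f [tuple of y :: v] 0%N /\
      forall k, (k < y)%N -> exists z, graph f [tuple of k :: v] z.+1
  end.

Lemma graph_inj n (f : recfun n) v y z : graph f v y -> graph f v z -> y = z.
Proof.
elim: f v y z => {n} [||n i|m n f IHf g IHg|n f IHf g IHg|n f IHf] v y z /=.
- by move=> -> ->.
- by move=> -> ->.
- by move=> -> ->.
- move=> [w hw fw] [w' hw' fw']; apply: IHf fw _.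
  rewrite (_ : w = w') //; apply: eq_from_tnth => i; exact: IHg (hw i) (hw' i).
- move=> [t [t0 tS ->]] [t' [t'0 t'S ->]].
  elim: {-2}(thead v) (leqnn (thead v)) => [|k IHk] lek; first exact: IHf t0 t'0.
  by have := tS _ lek; rewrite (IHk (ltnW lek)) => /IHg; apply; exact: t'S.
move=> [y0 yS] [z0 zS]; case: (ltngtP y z) => // lt.
  by have [u /(IHf _ _ _ y0)] := zS _ lt.
by have [u /(IHf _ _ _ z0)] := yS _ lt.
Qed.

(* A set of pairs (n, s) is c.e. if it is the domain of a partial recursive
   function, strings being coded by their position in the list sigma. *)
Definition ce (W : nat -> set (seq bool)) : Prop :=
  exists f : recfun 2, forall n s,
    W n s <-> exists y, graph f [tuple n; rank s] y.

Definition cylinder (s : seq bool) : set (nat -> bool) :=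
  [set x | mkseq x (size s) = s].

Definition cylinders : set (set (nat -> bool)) := range cylinder.

Notation cantor := (g_sigma_algebraType cylinders).

Section uniform_measure.
Context (R : realType).
Local Open Scope ring_scope.

Definition digits (r : R) : nat -> bool :=
  fun n => odd (Num.truncn (2 ^+ n.+1 * r)).

Lemma cylinder_rcons s b :
  cylinder (rcons s b) = cylinder s `&` [set x | x (size s) = b].
Proof.
apply/seteqP; split=> x; rewrite /cylinder /= size_rcons.
  by rewrite mkseqS => /rcons_inj[-> ->].
by case=> h1 h2; rewrite mkseqS h1 h2.
Qed.

Lemma measurable_truncn_eq (c : R) k :
  measurable [set r : measurableTypeR R | Num.truncn (c * r) = k].
Proof.
have mf n : measurable [set r : measurableTypeR R | (Num.truncn (c * r) <= n)%N].
  rewrite (_ : [set _ | _] = ( *%R c) @^-1` `]-oo, n.+1%:R[); last first.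
    by apply/seteqP; split=> r /=; rewrite in_itv /= truncn_le_nat.
  rewrite -[X in measurable X]setTI.
  by apply: (mulrl_measurable c) => //; exact: measurable_itv.
case: k => [|k].
  rewrite (_ : [set _ | _] = [set r | (Num.truncn (c * r) <= 0)%N]) //.
  by apply/seteqP; split=> r /=; rewrite leqn0 => /eqP.
rewrite (_ : [set _ | _] = [set r | (Num.truncn (c * r) <= k.+1)%N] `\`
   [set r | (Num.truncn (c * r) <= k)%N]).
  exact: measurableD.
apply/seteqP; split=> r /=; first by move=> ->; lia.
by case; lia.
Qed.

Lemma measurable_digits :
  measurable_fun [set: measurableTypeR R] (digits : measurableTypeR R -> cantor).
Proof.
apply: (@measurability _ _ (measurableTypeR R) cantor setT digits cylinders)
  => //.
move=> _ [_ [s _ <-] <-]; rewrite setTI.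
elim/last_ind: s => [|s b IH].
  rewrite (_ : _ @^-1` _ = setT) //.
  by apply/seteqP; split.
rewrite cylinder_rcons preimage_setI; apply: measurableI => //.
rewrite (_ : _ @^-1` _ = \bigcup_(k in [set k | odd k = b])
  [set r : measurableTypeR R | Num.truncn (2 ^+ (size s).+1 * r) = k]).
  by apply: bigcup_measurable => k _; exact: measurable_truncn_eq.
apply/seteqP; split=> r /=.
  by move=> h; exists (Num.truncn (2 ^+ (size s).+1 * r)).
by case=> k /= <- <-.
Qed.

(* The uniform measure is the law of the sequence of binary digits of a point
   chosen in [0, 1[ with Lebesgue measure; see [uniform_cylinder]. *)
Definition uniform_measure : set cantor -> \bar R :=
  pushforward (mrestr lebesgue_measure (measurable_itv `[0%R, 1%R[))
    (digits : measurableTypeR R -> cantor).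

Let uniform0 : uniform_measure set0 = 0%E.
Proof. by rewrite /uniform_measure /pushforward preimage_set0 measure0. Qed.

Let uniform_ge0 A : (0 <= uniform_measure A)%E.
Proof. by rewrite /uniform_measure /pushforward measure_ge0. Qed.

Let uniform_sigma_additive : semi_sigma_additive uniform_measure.
Proof.
exact: (@measure_semi_sigma_additive _ _ _
  (measure_function_pushforward__canonical__measure_function_Measure
     (mrestr lebesgue_measure (measurable_itv `[0%R, 1%R[)) measurable_digits)).
Qed.

HB.instance Definition _ := isMeasure.Build _ _ _ uniform_measure
  uniform0 uniform_ge0 uniform_sigma_additive.

Lemma digits_cylinder s :
  digits @^-1` cylinder s `&` `[0, 1[ =
  `[(binval s)%:R / 2 ^+ size s, (binval s).+1%:R / 2 ^+ size s[%classic.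
Proof.
have E (r : R) n k : 0 <= r -> (k%:R / 2 ^+ n <= r < k.+1%:R / 2 ^+ n) =
    (Num.truncn (2 ^+ n * r) == k).
  move=> r0; rewrite truncn_eq; last by rewrite mulr_ge0 // exprn_ge0.
  by rewrite ler_pdivrMr ?ltr_pdivlMr ?exprn_gt0 // mulrC.
suff H : forall r : R, 0 <= r < 1 ->
    (digits r \in cylinder s) = (Num.truncn (2 ^+ size s * r) == binval s).
  apply/seteqP; split=> r /=; rewrite !in_itv /=.
    by case=> h /[dup] /andP[r0 _] hr; rewrite E // -H //; exact: mem_set.
  move=> /[dup] h; have r0 : 0 <= r.
    by case/andP: h => h _; apply: le_trans h; rewrite divr_ge0 // exprn_ge0.
  have r01 : 0 <= r < 1.
    rewrite r0 /=; case/andP: h => _ /lt_le_trans; apply.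
    by rewrite ler_pdivrMr ?exprn_gt0 // mul1r -natrX ler_nat binval_lt.
  by rewrite E // -H // => /set_mem.
move=> r /andP[r0 r1]; elim/last_ind: s => [|s b IH].
  rewrite expr0 mul1r (_ : _ \in _ = true); last exact: mem_set.
  by rewrite (@truncn_def _ r 0) // r0.
rewrite cylinder_rcons in_setI IH binval_rcons size_rcons.
set m := Num.truncn (2 ^+ (size s).+1 * r).
have -> : (digits r \in [set x | x (size s) = b]) = (odd m == b).
  by apply/idP/eqP => [/set_mem|h]; [|apply: mem_set].
have -> : Num.truncn (2 ^+ size s * r) = m./2.
  have m0 : 0 <= 2 ^+ (size s).+1 * r by rewrite mulr_ge0 // exprn_ge0.
  have /andP[] := truncn_itv m0; rewrite -/m exprS -mulrA.
  set u := 2 ^+ size s * r => h1 h2; apply: truncn_def; move: h1 h2.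
  rewrite -{1 2}(odd_double_half m) -!natr1 natrD -muln2 natrM.
  by case: (odd m) => /= h1 h2; apply/andP; split; lra.
by rewrite -[in RHS](odd_double_half m); case: b; case: (odd m) => /=; lia.
Qed.

Lemma uniform_cylinder s : uniform_measure (cylinder s) = (2 ^- size s)%:E.
Proof.
rewrite /uniform_measure /pushforward /mrestr digits_cylinder.
rewrite lebesgue_measure_itv /= lte_fin ltr_pM2r ?invr_gt0 ?exprn_gt0 //.
by rewrite ltr_nat ltnSn -EFinD -mulrBl -natrB // subSnn mul1r.
Qed.

Let uniform_setT : uniform_measure setT = 1%E.
Proof.
rewrite (_ : setT = cylinder [::]) ?uniform_cylinder ?expr0 ?invr1 //.
by apply/seteqP; split.
Qed.

HB.instance Definition _ := Measure_isProbability.Build _ _ _ uniform_measure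
  uniform_setT.

Definition ml_test (U : nat -> set (nat -> bool)) : Prop :=
  (exists2 W : nat -> set (seq bool), ce W &
     forall n, U n = \bigcup_(s in W n) cylinder s) /\
  forall n, (uniform_measure (U n) <= (2 ^- n)%:E)%E.

Definition ml_random (x : nat -> bool) : Prop :=
  forall U, ml_test U -> ~ (\bigcap_n U n) x.

Definition random_online (F : (nat -> bool) -> (nat -> bool)) : Prop :=
  exists2 x, ml_random x & F = online x.

End uniform_measure.

(* Main.v *)
Require Import Defs.
From mathcomp Require Import all_boot all_order all_algebra.
From mathcomp Require Import all_classical all_reals all_analysis.
From mathcomp Require Import zify ring lra.

(* If F_x is injective then, for every n, compactness yields a level H at which
   any two strings differing in their first n + 1 bits already have different
   outputs; this is a c.e. open condition on x.  It forces, for each string r of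
   length n, the pairs (u, v) of extensions of r0 and r1 with equal outputs to
   die out before level H.  Retaining pairs so that no string is used twice, the
   surviving pairs contain a Galton-Watson process with offspring 0, 1, 2 of
   probabilities 1/8, 1/2, 3/8, whose extinction probability is 1/3; as r0 and
   r1 have equal outputs with probability 1/2, each r dies out with probability
   at most 1/2 + 1/6 = 2/3.  The events for the 2^n strings r are independent
   and (2/3)^(2^n) <= 2^-n, so these conditions form a Martin-Lof test. *)

Set Implicit Arguments.
Unset Strict Implicit.
Unset Printing Implicit Defensive.

Import Order.TTheory GRing.Theory Num.Theory.

(** * Partial recursive functions *)

(** Arguments are plain lists, which avoids casts between tuple types; only the values on lists of
    length [n] matter. *)
Definition computes n (f : seq nat -> nat) : Prop :=
  exists g : recfun n, forall v : n.-tuple nat, graph g v (f v).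

Lemma eq_computes n f f' :
  (forall v, size v = n -> f v = f' v) -> computes n f -> computes n f'.
Proof.
by move=> e [g hg]; exists g => v; rewrite -e ?size_tuple //; exact: hg.
Qed.

Lemma computes_var n i : i < n -> computes n (nth 0 ^~ i).
Proof.
move=> lt_in; exists (Proj (Ordinal lt_in)) => v /=.
by rewrite (tnth_nth 0).
Qed.

Lemma computes_comp m n f (g : nat -> seq nat -> nat) :
  computes m f -> (forall i, i < m -> computes n (g i)) ->
  computes n (fun v => f (mkseq (g ^~ v) m)).
Proof.
move=> [f' hf'] hg.
have /choice[g' hg'] (i : 'I_m) :
    exists g' : recfun n, forall v : n.-tuple nat, graph g' v (g i v).
  exact: hg.
exists (Comp f' g') => v /=.
exists [tuple of mkseq (g ^~ v) m]; last exact: hf'.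
move=> i; rewrite (tnth_nth 0) /= nth_mkseq //; exact: hg'.
Qed.

Lemma computes_rec n f g e :
  computes n f -> computes n.+2 g -> computes n e ->
  computes n (fun v => iteri (e v) (fun k r => g [:: k, r & v]) (f v)).
Proof.
move=> [f' hf'] [g' hg'] he.
have h : computes n.+1 (fun v =>
    iteri (head 0 v) (fun k r => g [:: k, r & behead v]) (f (behead v))).
  exists (PrimRec f' g') => v /=.
  exists (fun j => iteri j (fun k r => g [:: k, r & behead v]) (f (behead v))).
  split=> [|k _|].
  - exact: (hf' [tuple of behead v]).
  - exact: (hg' [tuple of k :: _ :: [tuple of behead v]]).
  - by case/tupleP: v => a v /=; rewrite theadE.
(* [PrimRec] recurses on the first argument, so [e] is substituted there and the parameters are
   shifted by one. *)
have /(computes_comp h) {h} : forall i, i < n.+1 ->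
    computes n (if i is j.+1 then nth 0 ^~ j else e).
  by case=> [|i] // lt_in; exact: computes_var.
apply: eq_computes => v sv /=.
rewrite (_ : map _ _ = v) //; rewrite -[RHS](mkseq_nth 0) sv.
by rewrite /mkseq (iotaDl 1 0) -map_comp.
Qed.

Lemma computes_succ n a : computes n a -> computes n (fun v => (a v).+1).
Proof.
move=> ha; apply: (@computes_comp 1 n (fun w => (head 0 w).+1) (fun=> a)) => //.
by exists Succ => v /=; case/tupleP: v => b v; rewrite theadE.
Qed.

Lemma computes_const n k : computes n (fun=> k).
Proof.
elim: k => [|k]; last exact: computes_succ.
apply: (@computes_comp 0 n (fun=> 0) (fun _ _ => 0)) => //.
by exists Zero.
Qed.

Definition computes1 (op : nat -> nat) : Prop :=
  computes 1 (fun w => op (nth 0 w 0)).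

Definition computes2 (op : nat -> nat -> nat) : Prop :=
  computes 2 (fun w => op (nth 0 w 0) (nth 0 w 1)).

Lemma computes_app1 op n a :
  computes1 op -> computes n a -> computes n (fun v => op (a v)).
Proof. by move=> hop ha; apply: (computes_comp (g := fun=> a) hop). Qed.

Lemma computes_app2 op n a b : computes2 op -> computes n a -> computes n b ->
  computes n (fun v => op (a v) (b v)).
Proof.
move=> hop ha hb.
by apply: (computes_comp (g := fun i => if i is 0 then a else b) hop); case.
Qed.

Lemma computes2_add : computes2 addn.
Proof.
have := computes_rec (@computes_var 2 0 isT)
  (computes_succ (@computes_var 4 1 isT)) (@computes_var 2 1 isT).
apply: eq_computes => v _ /=.
by elim: (nth 0 v 1) => [|k IH] /=; rewrite ?addn0 ?IH ?addnS.
Qed.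

Lemma computes2_mul : computes2 muln.
Proof.
have := computes_rec (computes_const 2 0)
  (computes_app2 computes2_add (@computes_var 4 1 isT) (@computes_var 4 2 isT))
  (@computes_var 2 1 isT).
apply: eq_computes => v _ /=.
by elim: (nth 0 v 1) => [|k IH] /=; rewrite ?muln0 ?IH ?mulnSr.
Qed.

Lemma computes1_pred : computes1 predn.
Proof.
have := computes_rec (computes_const 1 0) (@computes_var 3 0 isT)
  (@computes_var 1 0 isT).
by apply: eq_computes => v _ /=; case: (nth 0 v 0).
Qed.

Lemma computes2_sub : computes2 subn.
Proof.
have := computes_rec (@computes_var 2 0 isT)
  (computes_app1 computes1_pred (@computes_var 4 1 isT))
  (@computes_var 2 1 isT).
apply: eq_computes => v _ /=.
by elim: (nth 0 v 1) => [|k IH] /=; rewrite ?subn0 ?IH ?subnS.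
Qed.

Lemma computes1_odd : computes1 odd.
Proof.
have := computes_rec (computes_const 1 0)
  (computes_app2 computes2_sub (computes_const 3 1) (@computes_var 3 1 isT))
  (@computes_var 1 0 isT).
apply: eq_computes => v _ /=.
by elim: (nth 0 v 0) => [|k IH] //=; rewrite IH; case: odd.
Qed.

Lemma computes1_half : computes1 half.
Proof.
have := computes_rec (computes_const 1 0)
  (computes_app2 computes2_add
    (computes_app1 computes1_odd (@computes_var 3 0 isT))
    (@computes_var 3 1 isT))
  (@computes_var 1 0 isT).
apply: eq_computes => v _ /=.
by elim: (nth 0 v 0) => [|k IH] //=; rewrite IH -uphalf_half.
Qed.

Lemma computes2_iter_half : computes2 (fun j u => iter j half u).
Proof.
have := computes_rec (@computes_var 2 1 isT)
  (computes_app1 computes1_half (@computes_var 4 1 isT))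
  (@computes_var 2 0 isT).
by apply: eq_computes => v _ /=; elim: (nth 0 v 0) => [|k IH] //=; rewrite IH.
Qed.

Lemma computes1_exp2 : computes1 (expn 2).
Proof.
have := computes_rec (computes_const 1 1)
  (computes_app2 computes2_mul (computes_const 3 2) (@computes_var 3 1 isT))
  (@computes_var 1 0 isT).
apply: eq_computes => v _ /=.
by elim: (nth 0 v 0) => [|k IH] //=; rewrite IH expnS.
Qed.

Definition decides n (p : seq nat -> bool) : Prop := computes n p.

Lemma decides_leq n a b :
  computes n a -> computes n b -> decides n (fun v => a v <= b v).
Proof.
move=> ha hb; have := computes_app2 computes2_sub (computes_const n 1)
  (computes_app2 computes2_sub ha hb).
by apply: eq_computes => v _; rewrite /leq; case: (a v - b v).
Qed.

Lemma decides_and n p q :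
  decides n p -> decides n q -> decides n (fun v => p v && q v).
Proof.
move=> hp hq; have := computes_app2 computes2_mul hp hq.
by apply: eq_computes => v _; rewrite mulnb.
Qed.

Lemma decides_not n p : decides n p -> decides n (fun v => ~~ p v).
Proof.
move=> hp; have := computes_app2 computes2_sub (computes_const n 1) hp.
by apply: eq_computes => v _; case: (p v).
Qed.

Lemma decides_imp n p q :
  decides n p -> decides n q -> decides n (fun v => p v ==> q v).
Proof.
move=> hp hq; have := decides_not (decides_and hp (decides_not hq)).
by apply: eq_computes => v _; case: (p v) => //=; rewrite negbK.
Qed.

Lemma decides_eq n a b :
  computes n a -> computes n b -> decides n (fun v => a v == b v).
Proof.
move=> ha hb; have := decides_and (decides_leq ha hb) (decides_leq hb ha).
by apply: eq_computes => v _; rewrite eqn_leq.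
Qed.

(** The characteristic function is the product over [k < e v], built by primitive recursion. *)
Lemma decides_all n e p : computes n e -> decides n.+1 p ->
  decides n (fun v => all (fun k => p (k :: v)) (iota 0 (e v))).
Proof.
move=> he hp.
(* The recursion step receives [k], the accumulator and [v]; [p] has to skip the accumulator. *)
have hp' : computes n.+2 (fun w => p (nth 0 w 0 :: behead (behead w))).
  have /(computes_comp hp) : forall i, i < n.+1 ->
      computes n.+2 (nth 0 ^~ (if i is j.+1 then j.+2 else 0)).
    by case=> [|i] lt_in; exact: computes_var.
  apply: eq_computes => -[|k [|r v]] // [sv].
  rewrite /mkseq /= (_ : map _ _ = v) //; rewrite -[RHS](mkseq_nth 0) sv.
  by rewrite /mkseq (iotaDl 1 0) -map_comp.
have := computes_rec (computes_const n 1)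
  (computes_app2 computes2_mul (@computes_var n.+2 1 isT) hp') he.
apply: eq_computes => v _.
elim: (e v) => [|k IH] //; rewrite [LHS]/= IH mulnb.
by rewrite -[in RHS]addn1 iotaD all_cat /= andbT.
Qed.

(** [Mu] looks for a zero, so it is applied to the negation of [p]; as [p] is total, the search
    halts as soon as some [y] satisfies [p]. *)
Lemma mu_domain n p : decides n.+1 p -> exists f : recfun n,
  forall v : n.-tuple nat, (exists y, p (y :: v)) <-> exists y, graph f v y.
Proof.
move=> /decides_not[g hg]; exists (Mu g) => v.
split=> [ex|[y [hy _]]]; last first.
  exists y; have := graph_inj hy (hg [tuple of y :: v]).
  by rewrite /=; case: (p _).
exists (ex_minn ex); case: ex_minnP => y py miny /=; split.
  by have := hg [tuple of y :: v]; rewrite /= py.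
move=> k lt_ky; exists 0; have := hg [tuple of k :: v] => /=.
by case pk: (p _) => //; have := miny _ pk; rewrite leqNgt lt_ky.
Qed.

(** * Averages over finitely many bits *)

Definition upd (x : nat -> bool) (i : nat) (b : bool) : nat -> bool :=
  fun j => if j == i then b else x j.

Lemma updC x i j b c : i != j -> upd (upd x i b) j c = upd (upd x j c) i b.
Proof.
move=> /negPf nij; apply/funext => k; rewrite /upd.
by case: (eqVneq k j) => // ->; rewrite eq_sym nij.
Qed.

Lemma upd_upd x i b c : upd (upd x i b) i c = upd x i c.
Proof. by apply/funext => k; rewrite /upd; case: eqP. Qed.

Section average.
Context (R : realFieldType).
Local Open Scope ring_scope.
Implicit Types (phi psi : (nat -> bool) -> R) (l : seq nat) (c : R).

(* The expectation of phi when the bits of x at the positions in l are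
   replaced by independent fair coin flips. *)
Fixpoint avg l phi x : R :=
  if l is i :: l' then
    (avg l' phi (upd x i false) + avg l' phi (upd x i true)) / 2
  else phi x.

Lemma avg_cat l1 l2 phi : avg (l1 ++ l2) phi = avg l1 (avg l2 phi).
Proof. by apply/funext; elim: l1 => //= i l1 IH x; rewrite !IH. Qed.

Lemma ler_avg l phi psi x :
  (forall x', (forall i, i \notin l -> x' i = x i) -> phi x' <= psi x') ->
  avg l phi x <= avg l psi x.
Proof.
elim: l x => [|i l IH] x /= le_phi; first exact: le_phi.
have le b : avg l phi (upd x i b) <= avg l psi (upd x i b).
  apply: IH => x' ex'; apply: le_phi => j.
  by rewrite inE negb_or /upd => /andP[/negPf ji /ex' ->]; rewrite /upd ji.
by rewrite ler_pM2r ?invr_gt0 // lerD.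
Qed.

Lemma avg_const l c x : avg l (fun=> c) x = c.
Proof. by elim: l x => //= i l IH x; rewrite !IH; field. Qed.

Lemma avg_le_const l phi c x : (forall x', phi x' <= c) -> avg l phi x <= c.
Proof.
move=> h; apply: le_trans (_ : avg l (fun=> c) x <= c).
  by apply: ler_avg => x' _.
by rewrite avg_const.
Qed.

Lemma avgZ l c phi x : avg l (fun y => c * phi y) x = c * avg l phi x.
Proof. by elim: l x => //= i l IH x; rewrite !IH; field. Qed.

Lemma avg_comm l i phi : avg l (avg [:: i] phi) = avg [:: i] (avg l phi).
Proof.
apply/funext; elim: l => // j l IH x /=; rewrite !IH /=.
have [->|ne] := eqVneq i j; first by rewrite !upd_upd; field.
by rewrite !(updC _ _ _ ne); field.
Qed.

Lemma avg_absorb1 l i phi : i \in l -> avg l (avg [:: i] phi) = avg l phi.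
Proof.
elim: l => // j l IH; rewrite inE => /orP[/eqP <-|/IH e].
  by apply/funext => x; rewrite avg_comm /= !upd_upd; field.
by apply/funext => x /=; rewrite e.
Qed.

(** Averaging over one bit commutes with the other averages and is idempotent. A bound obtained on a
    short list thus carries over to a longer one. *)
Lemma avg_absorb l l' phi : {subset l' <= l} -> avg l (avg l' phi) = avg l phi.
Proof.
elim: l' => // i l' IH sub.
rewrite -cat1s avg_cat avg_absorb1; last by rewrite sub ?mem_head.
by apply: IH => j jl; rewrite sub // inE jl orbT.
Qed.

Lemma avg_sub_le l l' phi c x : {subset l' <= l} ->
  (forall x', avg l' phi x' <= c) -> avg l phi x <= c.
Proof. by move=> sub h; rewrite -(avg_absorb _ sub); exact: avg_le_const. Qed.

Definition depends (P : nat -> Prop) T (f : (nat -> bool) -> T) : Prop :=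
  forall x x', (forall i, P i -> x i = x' i) -> f x = f x'.

Lemma dependsW (P Q : nat -> Prop) T (f : (nat -> bool) -> T) :
  (forall i, P i -> Q i) -> depends P f -> depends Q f.
Proof. by move=> PQ h x x' e; apply: h => i /PQ; exact: e. Qed.

Local Notation event := ((nat -> bool) -> bool).

(** The bound is uniform in the bits outside [l], so it survives conditioning on them. *)
Definition prob_le c (P : nat -> Prop) (D : event) : Prop :=
  exists2 l : seq nat, (forall i, i \in l -> P i) &
    forall x, avg l (fun y => (D y)%:R) x <= c.

Lemma prob_leW c (P Q : nat -> Prop) D :
  (forall i, P i -> Q i) -> prob_le c P D -> prob_le c Q D.
Proof. by move=> PQ [l lP hl]; exists l => // i /lP/PQ. Qed.

(** Independence: [D1] does not read the bits in [l2], so it is a constant factor in the inner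
    average. *)
Lemma prob_le_and c1 c2 P Q (D1 D2 : event) : 0 <= c2 ->
  (forall i, P i -> ~ Q i) -> depends P D1 ->
  prob_le c1 P D1 -> prob_le c2 Q D2 ->
  prob_le (c1 * c2) (fun i => P i \/ Q i) (fun x => D1 x && D2 x).
Proof.
move=> c20 PQ dep [l1 l1P h1] [l2 l2Q h2]; exists (l1 ++ l2) => [i|x].
  by rewrite mem_cat => /orP[/l1P|/l2Q]; [left|right].
rewrite avg_cat mulrC.
apply: le_trans (_ : avg l1 (fun y => c2 * (D1 y)%:R) x <= _); last first.
  by rewrite avgZ ler_wpM2l.
apply: ler_avg => y _.
apply: le_trans (_ : avg l2 (fun z => (D1 y)%:R * (D2 z)%:R) y <= _).
  apply: ler_avg => z zy; rewrite -natrM mulnb (dep z y) // => i Pi.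
  by apply: zy; apply/negP => /l2Q; exact: PQ.
by rewrite avgZ mulrC ler_wpM2r.
Qed.

End average.

(** * Extinction of pairs with equal outputs *)

(* The positions in x of the bits coding f_x at the proper extensions of s. *)
Definition below (s : seq bool) (i : nat) : Prop :=
  exists c w, i = (rank (s ++ c :: w)).-1.

(** Positivity keeps the predecessor in [below] from identifying two strings. *)
Lemma rank_gt0 s c w : 0 < rank (s ++ c :: w).
Proof.
by case/lastP: w => [|w b]; rewrite ?cats1 -?rcons_cons -?rcons_cat rank_rcons.
Qed.

(** Strings of equal length with a common extension coincide. All independence used later rests on
    this. *)
Lemma below_disjoint s t i :
  size s = size t -> s <> t -> below s i -> ~ below t i.
Proof.
move=> est nst [c [w ->]] [d [z e]]; apply: nst.
have /rank_inj/eqP : rank (s ++ c :: w) = rank (t ++ d :: z).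
  by have := rank_gt0 s c w; have := rank_gt0 t d z; lia.
by rewrite eqseq_cat // => /andP[/eqP].
Qed.

Lemma below_rcons s b i : below (rcons s b) i -> below s i.
Proof. by move=> [c [w ->]]; exists b, (c :: w); rewrite cat_rcons. Qed.

Lemma below_child s b : below s (rank (rcons s b)).-1.
Proof. by exists b, [::]; rewrite cats1. Qed.

(** [below t] concerns strings longer than [t], hence longer than the child; so the bits at the
    children are not read again further down. *)
Lemma child_not_below s b t : size t = (size s).+1 ->
  ~ below t (rank (rcons s b)).-1.
Proof.
move=> st [c [w e]].
have /rank_inj/(congr1 size) : rank (rcons s b) = rank (t ++ c :: w).
  by have := rank_gt0 t c w; rewrite rank_rcons in e *; lia.
by rewrite size_rcons size_cat /=; lia.
Qed.

Lemma rcons_child_inj s t b c :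
  (rank (rcons s b)).-1 = (rank (rcons t c)).-1 -> s = t /\ b = c.
Proof.
move=> e; suff /rank_inj/rcons_inj[] : rank (rcons s b) = rank (rcons t c).
  by [].
by move: e; rewrite !rank_rcons; lia.
Qed.

(* [alive h s t x] says that f_x takes the same values along some extension
   of s by h bits and some extension of t by h bits; the values at s and t
   themselves are not compared. *)
Fixpoint alive h (s t : seq bool) (x : nat -> bool) : bool :=
  if h is h'.+1 then
    has (fun p : bool * bool =>
        (rep_fun x (rcons s p.1) == rep_fun x (rcons t p.2)) &&
        alive h' (rcons s p.1) (rcons t p.2) x)
      [:: (false, false); (false, true); (true, false); (true, true)]
  else true.

Lemma alive_depends h s t :
  depends (fun i => below s i \/ below t i) (alive h s t).
Proof.
elim: h s t => //= h IH s t x y e.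
have E i j : (rep_fun x (rcons s i) == rep_fun x (rcons t j)) &&
      alive h (rcons s i) (rcons t j) x =
    (rep_fun y (rcons s i) == rep_fun y (rcons t j)) &&
      alive h (rcons s i) (rcons t j) y.
  congr (_ && _).
    by rewrite /rep_fun !e //; [right|left]; exact: below_child.
  by apply: IH => k [] /below_rcons b; apply: e; [left|right].
by rewrite !E.
Qed.

(* For every extension r of s by m bits, no extensions of r0 and r1 by h bits
   have the same values of f_x from r0 and r1 on. *)
Fixpoint all_dead m h (s : seq bool) (x : nat -> bool) : bool :=
  if m is m'.+1 then
    all_dead m' h (rcons s false) x && all_dead m' h (rcons s true) x
  else ~~ ((rep_fun x (rcons s false) == rep_fun x (rcons s true)) &&
           alive h (rcons s false) (rcons s true) x).

Lemma all_dead_depends m h s : depends (below s) (all_dead m h s).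
Proof.
elim: m s => [|m IH] s x y e /=; last first.
  by congr (_ && _); apply: IH => i /below_rcons/e.
rewrite /rep_fun !(e _ (below_child _ _)); congr (~~ (_ && _)).
by apply: alive_depends => i [] /below_rcons/e.
Qed.

Section extinction.
Context (R : realFieldType).
Local Open Scope ring_scope.

Lemma avg_event_le (l l0 : seq nat) (c : R) (D0 D : (nat -> bool) -> bool) x :
  {subset l0 <= l} -> (forall y, avg l0 (fun y => (D0 y)%:R) y <= c) ->
  (forall y, (forall i, i \notin l -> y i = x i) -> D y -> D0 y) ->
  avg l (fun y => (D y)%:R) x <= c.
Proof.
move=> sub h imp; apply: le_trans (avg_sub_le x sub h).
apply: ler_avg => y /imp; rewrite ler_nat.
by case: (D y) => // /(_ isT) ->.
Qed.

(* Given the four bits read one level above s and t, the matched pairs of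
   children that use every child at most once evolve independently.  Their
   number is 0, 1 or 2 with probability 1/8, 1/2 and 3/8, and 1/3 is the fixed
   point q = 1/8 + q/2 + 3q^2/8 of this branching process. *)
Lemma alive_prob h s t : size s = size t -> s <> t ->
  prob_le (1 / 3 : R) (fun i => below s i \/ below t i)
    (fun x => ~~ alive h s t x).
Proof.
elim: h s t => [|h IH] s t est nst.
  by exists [::] => // x /=; lra.
have sz i j : size (rcons s i) = size (rcons t j) by rewrite !size_rcons est.
have ne i j : rcons s i <> rcons t j by move/rcons_inj => -[].
(* The positions strictly below the four children, to be averaged after the four bits at the
   children are fixed. *)
pose inner k := exists i j, below (rcons s i) k \/ below (rcons t j) k.
have neb (u : seq bool) : rcons u false <> rcons u true by move/rcons_inj=> -[].
have IH2 i j : prob_le (1 / 3 : R) inner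
    (fun x => ~~ alive h (rcons s i) (rcons t j) x).
  by apply: prob_leW (IH _ _ (sz i j) (ne i j)) => k; exists i, j.
(* For either perfect matching of the children, the two matched pairs read disjoint sets of bits, so
   they die out independently. *)
have two j : prob_le (1 / 3 * (1 / 3) : R) inner
    (fun x => ~~ alive h (rcons s false) (rcons t j) x &&
              ~~ alive h (rcons s true) (rcons t (~~ j)) x).
  have D u v i : size u = size v -> u <> v -> below u i -> ~ below v i.
    exact: below_disjoint.
  have nj : rcons t j <> rcons t (~~ j) by case: j => /rcons_inj[].
  apply: prob_leW (prob_le_and _ _ _ (IH _ _ (sz false j) (ne false j))
    (IH _ _ (sz true (~~ j)) (ne true (~~ j)))) => [i| |i|].
  - by case; [exists false, j|exists true, (~~ j)].
  - by lra.
  - by case=> b [] /(D _ _ _ _ _ b); apply; rewrite ?size_rcons ?est //;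
      apply/nesym/ne.
  - by move=> x y /alive_depends ->.
pose p0 := (rank (rcons s false)).-1; pose p1 := (rank (rcons s true)).-1.
pose q0 := (rank (rcons t false)).-1; pose q1 := (rank (rcons t true)).-1.
have innerN k : inner k -> k \notin [:: p0; p1; q0; q1].
  move=> [i [j b]]; apply/negP; rewrite !inE.
  by case/or4P => /eqP e; move: b; rewrite e => -[];
    apply: child_not_below; rewrite size_rcons ?est.
have [l00 b00 h00] := IH2 false false; have [l01 b01 h01] := IH2 false true.
have [l10 b10 h10] := IH2 true false; have [l11 b11 h11] := IH2 true true.
have [m0 c0 k0] := two false; have [m1 c1 k1] := two true.
(* A single list serves all cases, each bound being transferred to it by [avg_event_le]. *)
pose l := l00 ++ l01 ++ l10 ++ l11 ++ m0 ++ m1.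
have l_inner (i : nat) : i \in l -> inner i.
  rewrite !mem_cat.
  by move=> /or4P[/b00|/b01|/b10|/or3P[/b11|/c0|/c1]].
exists ([:: p0; p1; q0; q1] ++ l) => [i|x].
  rewrite mem_cat => /orP[|/l_inner [a [b]]]; last first.
    by case=> /below_rcons; [left|right].
  rewrite !inE; case/or4P => /eqP ->; [left|left|right|right];
    exact: below_child.
(* Bound on extinction given the bits [a], [b] below [s] and [c], [d] below [t]: 1/9 for a perfect
   matching, 1/3 for some match, 1 otherwise. *)
pose g (a b c d : bool) : R :=
  if (a == c) && (b == d) || (a == d) && (b == c) then 1 / 3 * (1 / 3)
  else if [|| a == c, a == d, b == c | b == d] then 1 / 3 else 1.
rewrite avg_cat.
apply: le_trans (_ : avg [:: p0; p1; q0; q1]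
  (fun y => g (y p0) (y p1) (y q0) (y q1)) x <= _).
  apply: ler_avg => y _ {x}.
  have bits z : (forall i, i \notin l -> z i = y i) ->
      [/\ z p0 = y p0, z p1 = y p1, z q0 = y q0 & z q1 = y q1].
    move=> e; split; apply: e; apply/negP => /l_inner/innerN;
      by rewrite !inE eqxx ?orbT.
  rewrite /g.
  have step (l0 : seq nat) (c : R) (D0 : (nat -> bool) -> bool) :
      {subset l0 <= l} ->
      (forall y, avg l0 (fun y => (D0 y)%:R) y <= c) ->
      (forall z, ~~ has (fun p : bool * bool =>
        ((if p.1 then y p1 else y p0) == (if p.2 then y q1 else y q0)) &&
        alive h (rcons s p.1) (rcons t p.2) z)
        [:: (false, false); (false, true); (true, false); (true, true)] ->
        D0 z) ->
      avg l (fun z => (~~ alive h.+1 s t z)%:R) y <= c.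
    move=> s0 hc imp; apply: avg_event_le s0 hc _ => z /bits[e0 e1 e2 e3] d.
    by apply: imp; rewrite -e0 -e1 -e2 -e3.
  have S : [/\ {subset l00 <= l}, {subset l01 <= l}, {subset l10 <= l},
      {subset l11 <= l} & {subset m0 <= l} /\ {subset m1 <= l}].
    by split; try split; move=> i hi; rewrite !mem_cat hi ?orbT.
  case: S => s00 s01 s10 s11 [s0 s1].
  case: ifP => [/orP[]/andP[/eqP e0 /eqP e1]|_].
  - apply: step s0 k0 _ => z; rewrite /= e0 e1 !eqxx /=.
    by rewrite !negb_or => /and5P[-> _ _ ->].
  - apply: step s1 k1 _ => z; rewrite /= e0 e1 !eqxx /=.
    by rewrite !negb_or => /and5P[_ -> ->].
  case: ifP => [/or4P[]/eqP e|_].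
  - apply: step s00 h00 _ => z; rewrite /= e !eqxx /=.
    by rewrite !negb_or => /andP[].
  - apply: step s01 h01 _ => z; rewrite /= e !eqxx /=.
    by rewrite !negb_or => /and3P[].
  - apply: step s10 h10 _ => z; rewrite /= e !eqxx /=.
    by rewrite !negb_or => /and4P[].
  - apply: step s11 h11 _ => z; rewrite /= e !eqxx /=.
    by rewrite !negb_or => /and5P[].
  by apply: avg_le_const => z; case: alive => //=; rewrite ?ler01 ?ler_nat.
(* The four positions are distinct, so the outer average runs over all 16 values: 3/8 * 1/9 + 1/2 *
   1/3 + 1/8 = 1/3. *)
have N u v b c : (u <> v) \/ (b <> c) -> 
    ((rank (rcons u b)).-1 == (rank (rcons v c)).-1) = false.
  by move=> d; apply/eqP => /rcons_child_inj[? ?]; case: d.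
have E1 : ((p0 == p1) = false) * ((p1 == p0) = false) * ((q0 == q1) = false) *
    ((q1 == q0) = false) by do !split; apply: N; right.
have nts := nesym nst.
have E2 : ((p0 == q0) = false) * ((p0 == q1) = false) * ((p1 == q0) = false) *
    ((p1 == q1) = false) by do !split; apply: N; left.
have E3 : ((q0 == p0) = false) * ((q0 == p1) = false) * ((q1 == p0) = false) *
    ((q1 == p1) = false) by do !split; apply: N; left.
by rewrite /= /upd !eqxx !(E1, E2, E3) /g /=; lra.
Qed.
(** The subtrees at the two children of [s] read disjoint bits, so each further level squares the
    bound. *)
Lemma all_dead_prob m h s :
  prob_le ((2 / 3) ^+ (2 ^ m) : R) (below s) (all_dead m h s).
Proof.
elim: m s => [|m IH] s; last first.
  rewrite expnS mul2n -addnn exprD.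
  apply: prob_leW (prob_le_and _ _ _ (IH (rcons s false)) (IH (rcons s true))).
  - by move=> i [] /below_rcons.
  - by apply: exprn_ge0; lra.
  - by move=> i; apply: below_disjoint; rewrite ?size_rcons // => /rcons_inj[].
  - exact: all_dead_depends.
have [||l lP hl] := @alive_prob h (rcons s false) (rcons s true).
- by rewrite !size_rcons.
- by move/rcons_inj.
pose p0 := (rank (rcons s false)).-1; pose p1 := (rank (rcons s true)).-1.
exists ([:: p0; p1] ++ l) => [i|x].
  rewrite mem_cat => /orP[|/lP[] /below_rcons //].
  by rewrite !inE => /orP[] /eqP ->; exact: below_child.
have lN b : (rank (rcons s b)).-1 \notin l.
  by apply/negP => /lP[]; apply: child_not_below; rewrite size_rcons.
rewrite avg_cat.
(* Bound given the two bits at the children of [s]; its average is 1/2 * 1/3 + 1/2 = 2/3. *)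
apply: le_trans (_ : avg [:: p0; p1]
  (fun y => if y p0 == y p1 then 1 / 3 else 1) x <= _).
  apply: ler_avg => y _; case: ifP => [e|_].
    apply: avg_event_le hl _ => // z zy /=.
    by rewrite /rep_fun !zy ?lN // e.
  by apply: avg_le_const => z; case: all_dead; rewrite ?ler01 ?ler_nat.
have N b c : b <> c ->
    ((rank (rcons s b)).-1 == (rank (rcons s c)).-1) = false.
  by move=> d; apply/eqP => /rcons_child_inj[_ /d].
by rewrite /= /upd !eqxx !N //=; lra.
Qed.

End extinction.

(** * Separation of strings at a finite level *)

Definition agree (x : nat -> bool) (s t : seq bool) : bool :=
  all (fun k => rep_fun x (take k.+1 s) == rep_fun x (take k.+1 t))
    (iota 0 (size s)).

Lemma agree_refl x s : agree x s s.
Proof. by apply/allP. Qed.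

Lemma agree_rcons x s t a b : size s = size t ->
  agree x (rcons s a) (rcons t b) =
  agree x s t && (rep_fun x (rcons s a) == rep_fun x (rcons t b)).
Proof.
move=> e; rewrite /agree size_rcons -addn1 iotaD all_cat /= andbT.
rewrite !take_oversize ?size_rcons ?e //; congr (_ && _).
apply: eq_in_all => k; rewrite mem_iota /= => lt_k.
by rewrite -!cats1 !takel_cat // e.
Qed.

Lemma alive_agree h s t x : size s = size t -> agree x s t -> alive h s t x ->
  exists u v, [/\ size u = h, size v = h & agree x (s ++ u) (t ++ v)].
Proof.
elim: h s t => [|h IH] s t e st; first by exists [::], [::]; rewrite !cats0.
move=> /hasP[[i j] _ /= /andP[f /IH[||u [v [su sv a]]]]].
- by rewrite !size_rcons e.
- by rewrite agree_rcons // st.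
by exists (i :: u), (j :: v); rewrite /= su sv -!cat_rcons.
Qed.

(** A surviving pair starts at [r0] and [r1] for some extension [r] of [s] by [m] bits: the two
    strings share [m] bits, branch at the next one and go on for [h] bits. *)
Lemma not_all_dead m h s x : ~~ all_dead m h s x -> exists u v,
  [/\ size u = (m + h).+1, size v = (m + h).+1, agree x (s ++ u) (s ++ v)
    & take m.+1 u <> take m.+1 v].
Proof.
elim: m s => [|m IH] s /=; last first.
  rewrite negb_and => /orP[] /IH[u [v [su sv a d]]].
    exists (false :: u), (false :: v); rewrite /= su sv -!cat_rcons.
    by split=> // -[].
  exists (true :: u), (true :: v); rewrite /= su sv -!cat_rcons.
  by split=> // -[].
rewrite negbK => /andP[f /alive_agree[||u [v [su sv a]]]].
- by rewrite !size_rcons.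
- by rewrite agree_rcons // agree_refl.
exists (false :: u), (true :: v); rewrite /= su sv -!cat_rcons.
by split.
Qed.

(* The n-th set of the test is the union over H of these events: f_x separates
   every two strings of length H that differ in their first n+1 bits. *)
Definition separates n H (x : nat -> bool) : bool :=
  (n < H) && [forall s : H.-tuple bool, forall t : H.-tuple bool,
    agree x s t ==> (take n.+1 s == take n.+1 t)].

Lemma separatesP n H x : reflect
  (n < H /\ forall s t, size s = H -> size t = H -> agree x s t ->
    take n.+1 s = take n.+1 t)
  (separates n H x).
Proof.
apply: (iffP andP) => -[nH sep]; split=> //.
  move=> s t /eqP sH /eqP tH a.
  by move/forallP/(_ (Tuple sH))/forallP/(_ (Tuple tH))/implyP/(_ a)/eqP: sep.
apply/forallP => s; apply/forallP => t; apply/implyP => a; apply/eqP.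
by apply: sep; rewrite ?size_tuple.
Qed.

Lemma separates_S n H x : separates n H x -> separates n H.+1 x.
Proof.
move=> /separatesP[nH sep]; apply/separatesP; split=> [|s t]; first exact: ltnW.
case/lastP: s => // s a; case/lastP: t => // t b.
rewrite !size_rcons => -[sH] [tH]; rewrite agree_rcons ?sH ?tH //.
move=> /andP[ag _]; have := sep s t sH tH ag.
by rewrite -!cats1 !takel_cat ?sH ?tH.
Qed.

Lemma separates_all_dead n h x :
  separates n (n + h).+1 x -> all_dead n h [::] x.
Proof.
move=> /separatesP[_ sep]; apply/negPn/negP => /not_all_dead.
by move=> [u [v [su sv a]]]; apply; exact: sep.
Qed.

(** There are 2^(H+1) - 2 nonempty strings of length at most [H], and they come first in the
    enumeration after the empty string. *)
Lemma separates_depends n H :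
  depends (fun i => i < (2 ^ H).*2 - 2) (separates n H).
Proof.
move=> x y e; congr (_ && _); apply: eq_forallb => s; apply: eq_forallb => t.
congr (_ ==> _); apply: eq_in_all => k.
rewrite mem_iota size_tuple add0n => /= kH.
have lt (u : H.-tuple bool) : (rank (take k.+1 u)).-1 < (2 ^ H).*2 - 2.
  have := binval_lt (take k.+1 u).
  rewrite rank_binval size_takel ?size_tuple //.
  have : 2 ^ k.+1 <= 2 ^ H by rewrite leq_exp2l.
  by have : 0 < 2 ^ k; rewrite ?expn_gt0 // expnS; lia.
by rewrite /rep_fun !e.
Qed.

(** * Compactness *)

Lemma konig (A : finType) (T : seq A -> Prop) :
  (forall s a, T (rcons s a) -> T s) ->
  (forall n, exists2 s, size s = n & T s) ->
  exists f : nat -> A, forall n, T (mkseq f n).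
Proof.
move=> closed deep.
have closed_cat s t : T (s ++ t) -> T s.
  elim/last_ind: t => [|t a IH]; rewrite ?cats0 // -rcons_cat.
  by move=> /closed.
pose inf s := forall n, exists2 t, size t = n & T (s ++ t).
(* If no child of [s] had arbitrarily long extensions, the maximum of the finitely many bounds would
   bound the extensions of [s]. *)
have step s : exists a, inf s -> inf (rcons s a).
  apply: contrapT => /forallNP none.
  have infs : inf s.
    by have [[|a t] // _ _] := deep 1; have /not_implyP[] := none a.
  have /choice[N hN] a : exists n, forall t, size t = n -> ~ T (rcons s a ++ t).
    have /not_implyP[_ /existsNP[n hn]] := none a.
    by exists n => t st Tt; apply: hn; exists t.
  have [t] := infs (\max_a N a).+1.
  case: t => // a t [st]; rewrite -cat_rcons => Tt.
  apply: (hN a (take (N a) t)).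
    by rewrite size_takel // st; exact: leq_bigmax.
  by apply: closed_cat (drop (N a) t) _; rewrite -catA cat_take_drop.
have [nxt hnxt] := choice step.
pose S n := iter n (fun s => rcons s (nxt s)) [::].
exists (fun n => nxt (S n)) => n.
have -> : mkseq (fun n => nxt (S n)) n = S n.
  by elim: n => // n IH; rewrite mkseqS IH.
have infS : inf (S n) by elim: n => [|n IH] //=; exact: hnxt.
by have [t] := infS 0; case: t => //; rewrite cats0.
Qed.

(** Without a separating level, the tree of pairs with equal outputs that differ early is infinite;
    a branch gives two distinct inputs with the same output. *)
Lemma injective_separates n x : injective (online x) ->
  exists H, separates n H x.
Proof.
move=> inj; apply: contrapT => /forallNP nsep.
(* The difference is required only at lengths above [n], which keeps the tree closed under
   prefixes. *)
pose T (w : seq (bool * bool)) := agree x (unzip1 w) (unzip2 w) /\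
  (n < size w -> take n.+1 (unzip1 w) <> take n.+1 (unzip2 w)).
have sz (w : seq (bool * bool)) : size (unzip1 w) = size (unzip2 w).
  by rewrite !size_map.
have [|H|f fT] := @konig _ T.
- move=> w [a b] []; rewrite /unzip1 /unzip2 !map_rcons agree_rcons ?sz //=.
  move=> /andP[ag _] d; split=> // lt_n; move: d.
  rewrite size_rcons -!cats1 !takel_cat ?size_map //; apply.
  exact: ltnW.
(* [separates] fails trivially at levels up to [n], so a pair is taken at a level above [n] and then
   truncated to length [H]. *)
- have [w sw Tw] : exists2 w, size w = maxn H n.+1 & T w.
    have /not_andP[|/existsNP[s /existsNP[t]]] :=
      fun h => nsep (maxn H n.+1) (introT (separatesP _ _ _) h); first by lia.
    move=> /not_implyP[ss /not_implyP[st /not_implyP[a d]]].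
    exists (zip s t); first by rewrite size_zip ss st minnn.
    by rewrite /T unzip1_zip ?unzip2_zip ?ss ?st.
  exists (take H w); first by rewrite size_takel // sw leq_maxl.
  move: Tw; rewrite /T => -[a d]; split.
    apply/allP => k; rewrite mem_iota size_map size_takel ?sw ?leq_maxl //=.
    move=> kH; rewrite /unzip1 /unzip2 !map_take !take_takel //.
    by move/allP: a; apply; rewrite mem_iota size_map sw; lia.
  rewrite size_takel ?sw ?leq_maxl // => nH.
  rewrite /unzip1 /unzip2 !map_take !take_takel //.
  by apply: d; rewrite sw; lia.
have U1 k : unzip1 (mkseq f k) = mkseq (fst \o f) k.
  by rewrite /mkseq [RHS]map_comp.
have U2 k : unzip2 (mkseq f k) = mkseq (snd \o f) k.
  by rewrite /mkseq [RHS]map_comp.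
have /(congr1 (fun y => mkseq y n.+1)) : fst \o f = snd \o f.
  apply: inj; apply/funext => k.
  have [+ _] := fT k.+1; rewrite U1 U2 => /allP/(_ k).
  rewrite mem_iota size_mkseq ltnSn => /(_ isT)/eqP.
  by rewrite /online !take_oversize ?size_mkseq.
have [_] := fT n.+1; rewrite size_mkseq ltnSn U1 U2 => /(_ isT).
by rewrite !take_oversize ?size_mkseq.
Qed.

(** * Uniform measure of events *)

Section measure_of_events.
Context (R : realType).
Local Open Scope ring_scope.
Local Open Scope classical_set_scope.

Lemma measurable_cylinder s : measurable (cylinder s : set cantor).
Proof. by apply: sub_sigma_algebra; exists s. Qed.

(** Links averages to the measure by splitting the cylinder on its next bit; once [L] bits are
    fixed, [D] is constant. The point [x] only represents the cylinder. *)
Lemma uniform_cylinder_event L (D : (nat -> bool) -> bool) k s x :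
  depends (fun i => (i < L)%N) D -> (size s + k)%N = L -> cylinder s x ->
  measurable (cylinder s `&` [set y | D y] : set cantor) /\
  uniform_measure R (cylinder s `&` [set y | D y]) =
    (2 ^- size s * avg (iota (size s) k) (fun y => (D y)%:R : R) x)%:E.
Proof.
move=> dep; elim: k s x => [|k IH] s x sL sx.
  have DE y : cylinder s y -> D y = D x.
    move=> sy; apply: dep => i; rewrite -sL addn0 => lt_i.
    have : mkseq y (size s) = mkseq x (size s) by rewrite sy sx.
    by move/(congr1 (nth false ^~ i)); rewrite !nth_mkseq.
  have [Dx|Dx] := boolP (D x).
    rewrite (_ : _ `&` _ = cylinder s); last first.
      by apply/seteqP; split=> [y []//|y sy]; split=> //=; rewrite DE.
    by split; [exact: measurable_cylinder|rewrite uniform_cylinder /= Dx mulr1].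
  rewrite (_ : _ `&` _ = set0).
    by split; [exact: measurable0|rewrite measure0 /= (negPf Dx) mulr0].
  by apply/seteqP; split=> // y [/DE /= ->]; rewrite (negPf Dx).
have child b : cylinder (rcons s b) (upd x (size s) b).
  rewrite cylinder_rcons; split; last by rewrite /upd /= eqxx.
  rewrite /cylinder /= -[in RHS]sx; apply/eq_in_map => i.
  by rewrite mem_iota /upd => /andP[_] lt_i; rewrite ltn_eqF.
have [|mf uf] := IH (rcons s false) _ _ (child false).
  by rewrite size_rcons addSnnS.
have [|mt ut] := IH (rcons s true) _ _ (child true).
  by rewrite size_rcons addSnnS.
have -> : cylinder s `&` [set y | D y] =
    (cylinder (rcons s false) `&` [set y | D y]) `|`
    (cylinder (rcons s true) `&` [set y | D y]).
  rewrite -setIUl !cylinder_rcons -setIUr; congr (_ `&` _).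
  apply/seteqP; split=> y; last by case.
  by case e : (y (size s)) => sy; split=> //; [right|left].
split; first exact: measurableU.
transitivity (uniform_measure R (cylinder (rcons s false) `&` [set y | D y]) +
    uniform_measure R (cylinder (rcons s true) `&` [set y | D y]))%E.
  apply: measureU => //; rewrite setIACA setIid !cylinder_rcons.
  apply/seteqP; split=> // y [] [].
  by move=> [_ /= ->] [].
rewrite uf ut -EFinD !size_rcons /=; congr (_ %:E).
rewrite exprS invfM; field.
by rewrite expf_neq0 // pnatr_eq0.
Qed.

Lemma uniform_event_le L (D D' : (nat -> bool) -> bool) P (c : R) :
  depends (fun i => (i < L)%N) D -> (forall x, D x -> D' x) ->
  prob_le c P D' ->
  measurable ([set x | D x] : set cantor) /\
  (uniform_measure R [set x | D x] <= c%:E)%E.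
Proof.
move=> dep DD' [l _ hl].
(* Large enough for the first [M] bits to decide [D] and to include every position in [l]. *)
pose M := maxn L (\max_(i <- l) i).+1.
have depM : depends (fun i => (i < M)%N) D.
  by apply: dependsW dep => i; rewrite /M leq_max => ->.
have [|//|mD uD] :=
    @uniform_cylinder_event M D M [::] (fun=> false) depM; first by [].
rewrite (_ : cylinder [::] `&` _ = [set x | D x]) in mD uD; last first.
  by apply/seteqP; split=> [y []//|y yD]; split.
split=> //; rewrite uD lee_fin expr0 invr1 mul1r.
apply: le_trans (_ : avg (iota 0 M) (fun y => (D' y)%:R) (fun=> false) <= _).
  apply: ler_avg => y _; rewrite ler_nat.
  by have := DD' y; case: (D y) => // ->.
apply: avg_sub_le hl => i il; rewrite mem_iota /= add0n /M leq_max ltnS.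
by rewrite (@leq_bigmax_seq _ _ xpredT id) ?orbT.
Qed.

End measure_of_events.

(** * The Martin-Lof test *)

Lemma rankS s : (rank s).+1 = 2 ^ size s + binval s.
Proof. by rewrite rank_binval prednK // addn_gt0 expn_gt0. Qed.

Lemma size_eq_rank s L :
  (size s == L) = (2 ^ L <= (rank s).+1 < 2 ^ L.+1).
Proof.
rewrite rankS; have := binval_lt s.
case: (ltngtP (size s) L) => [lt|lt|<-].
- have : 2 ^ (size s).+1 <= 2 ^ L by rewrite leq_exp2l.
  by rewrite expnS; lia.
- have : 2 ^ L.+1 <= 2 ^ size s by rewrite leq_exp2l.
  by lia.
by rewrite expnS; lia.
Qed.

(* Numbering the node s of the binary tree by (rank s).+1 makes halving the
   parent map. *)
Lemma iter_half_rank s j : j <= size s ->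
  iter j half (rank s).+1 = (rank (take (size s - j) s)).+1.
Proof.
elim: j => [|j IH] le_j; first by rewrite subn0 take_size.
rewrite iterS IH; last exact: ltnW.
rewrite -subSS subSn // (take_nth false) ?rank_rcons; last by lia.
by case: (nth _ _ _) => /=; lia.
Qed.

Lemma nth_rank s i : i < size s ->
  nth false s i = odd (iter (size s - i.+1) half (rank s).+1).
Proof.
move=> lt_i; rewrite iter_half_rank ?leq_subr // subKn //.
by rewrite (take_nth false) // rank_rcons /=; case: (nth _ _ _) => /=; lia.
Qed.

(* If r is the rank of a string x of length 2^(H+1) - 2, this is the value of
   f_x at the node p > 1. *)
Definition label H r p : bool := odd (iter (2 * 2 ^ H - 1 - p) half r.+1).

(** Quantified variables come first, innermost in front, as [decides_all] expects. The numbers [u]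
    and [v] are binary values of strings of length [H]; [j] halvings of [2 ^ H + u] number the
    prefix of length [H - j]. *)
Definition test_labels (w : seq nat) : bool :=
  if w is [:: j, v, u, H, n, r & _] then
    label H r (iter j half (2 ^ H + u)) == label H r (iter j half (2 ^ H + v))
  else false.

Definition test_nodes (w : seq nat) : bool :=
  if w is [:: v, u, H, n & _] then
    all (fun j => test_labels (j :: w)) (iota 0 H) ==>
    (iter (H - n.+1) half (2 ^ H + u) == iter (H - n.+1) half (2 ^ H + v))
  else false.

(** [H] stands in front as the variable of the unbounded search. The inequalities on [r.+1] say that
    the string of rank [r] has length 2^(H+1) - 2. *)
Definition test (w : seq nat) : bool :=
  if w is [:: H, n, r & _] then
    [&& n < H, 2 ^ (2 * 2 ^ H - 2) <= r.+1, r.+1 < 2 ^ (2 * 2 ^ H - 1) &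
      all (fun u => all (fun v => test_nodes [:: v, u & w]) (iota 0 (2 ^ H)))
        (iota 0 (2 ^ H))]
  else false.

Lemma decides_test : decides 3 test.
Proof.
have var n i : i < n -> computes n (nth 0 ^~ i) by exact: computes_var.
have exp2 n a : computes n a -> computes n (fun v => 2 ^ a v).
  exact: computes_app1 computes1_exp2.
have sub n a b : computes n a -> computes n b ->
    computes n (fun v => a v - b v) by exact: computes_app2 computes2_sub.
have add n a b : computes n a -> computes n b ->
    computes n (fun v => a v + b v) by exact: computes_app2 computes2_add.
have mul n a b : computes n a -> computes n b ->
    computes n (fun v => a v * b v) by exact: computes_app2 computes2_mul.
have halves n a b : computes n a -> computes n b ->
    computes n (fun v => iter (a v) half (b v)).
  exact: (computes_app2 computes2_iter_half).
have bit n a : computes n a -> computes n (fun v => odd (a v)).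
  exact: computes_app1 computes1_odd.
have const := computes_const; have succ := computes_succ.
have node n k l i : k < n -> l < n -> computes n i ->
    computes n (fun w => iter (i w) half (2 ^ nth 0 w k + nth 0 w l)).
  by move=> ltk ltl hi; apply: (halves) => //; apply: (add); auto.
have lab n k l p : k < n -> l < n -> computes n p ->
    computes n (fun w => label (nth 0 w k) (nth 0 w l) (p w)).
  move=> ltk ltl hp; apply: (bit); apply: (halves); last by apply: (succ); auto.
  by apply: (sub) => //; apply: (sub) => //; apply: (mul) => //; auto.
have labels : decides 6 test_labels.
  have := decides_eq
    (lab 6 3 5 _ isT isT (node 6 3 2 _ isT isT (var 6 0 isT)))
    (lab 6 3 5 _ isT isT (node 6 3 1 _ isT isT (var 6 0 isT))).
  apply: eq_computes => -[|j [|v [|u [|H [|n [|r w]]]]]] //= _.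
  by case: label; case: label.
have nodes : decides 5 test_nodes.
  have depth : computes 5 (fun w => nth 0 w 2 - (nth 0 w 3).+1).
    by apply: (sub); [exact: (var)|apply: (succ); exact: (var)].
  have := decides_imp (decides_all (var 5 2 isT) labels)
    (decides_eq (node 5 2 1 _ isT isT depth) (node 5 2 0 _ isT isT depth)).
  by apply: eq_computes => -[|v [|u [|H [|n w]]]].
have size2 : computes 3 (fun w => 2 * 2 ^ nth 0 w 0).
  by apply: (mul); [exact: (const)|apply: (exp2); exact: (var)].
have rS : computes 3 (fun w => (nth 0 w 2).+1) by apply: (succ); exact: (var).
have := decides_and (decides_leq (succ _ _ (var 3 1 isT)) (var 3 0 isT))
  (decides_and (decides_leq (exp2 _ _ (sub _ _ _ size2 (const 3 2))) rS)
  (decides_and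
    (decides_leq (succ _ _ rS) (exp2 _ _ (sub _ _ _ size2 (const 3 1))))
    (decides_all (exp2 _ _ (var 3 0 isT))
      (decides_all (exp2 _ _ (var 4 1 isT)) nodes)))).
by apply: eq_computes => -[|H [|n [|r w]]].
Qed.

(** The bit of [x] at position [(rank t).-1] appears after [size x - rank t] halvings, which is the
    exponent in [label] at the node [(rank t).+1]. *)
Lemma label_rep_fun H (x t : seq bool) :
  size x = (2 ^ H).*2 - 2 -> 0 < size t <= H ->
  label H (rank x) (rank t).+1 = rep_fun (nth false x) t.
Proof.
move=> sx /andP[t0 tH].
have lt_t : (rank t).-1 < size x.
  have : 2 ^ size t <= 2 ^ H by rewrite leq_exp2l.
  have : 2 <= 2 ^ size t by rewrite -{1}[2]expn1 leq_exp2l.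
  by have := rankS t; have := binval_lt t; rewrite sx; lia.
rewrite /rep_fun nth_rank // /label sx.
case/lastP: t t0 {lt_t tH} => // t b _; rewrite rank_rcons /=.
by congr (odd (iter _ _ _)); have := expn_gt0 2 H; lia.
Qed.

Lemma testP H n (x : seq bool) :
  test [:: H; n; rank x] =
  (size x == (2 ^ H).*2 - 2) && separates n H (nth false x).
Proof.
have pow : 0 < 2 ^ H by rewrite expn_gt0.
have L1 : ((2 ^ H).*2 - 2).+1 = 2 * 2 ^ H - 1 by lia.
have L2 : 2 * 2 ^ H - 2 = (2 ^ H).*2 - 2 by lia.
rewrite /test /separates L2 -L1.
rewrite (andbA (2 ^ _ <= _)) -size_eq_rank andbCA.
have [/eqP sx|//] := boolP (size x == _); congr (_ && _).
have node (s : seq bool) : size s = H -> 2 ^ H + binval s = (rank s).+1.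
  by rewrite rankS => ->.
have agreeE (s t : H.-tuple bool) :
    all (fun j => test_labels [:: j; binval t; binval s; H; n; rank x])
      (iota 0 H) = agree (nth false x) s t.
  have lab (u : H.-tuple bool) j : j < H ->
      label H (rank x) (iter j half (2 ^ H + binval u)) =
      rep_fun (nth false x) (take (H - j) u).
    move=> jH; rewrite node ?size_tuple // iter_half_rank ?size_tuple 1?ltnW //.
    by rewrite label_rep_fun // size_takel ?size_tuple ?leq_subr // subn_gt0 jH.
  (* The test counts levels up from the leaves and [agree] counts prefix lengths, hence the reversal
     of indices. *)
  apply/allP/allP => h j; rewrite mem_iota ?size_tuple /= => jH.
    have := h (H - j.+1); rewrite mem_iota /= lab ?lab; [|lia..].
    by rewrite subKn //; apply; lia.
  rewrite !lab //; have := h (H - j.+1); rewrite mem_iota size_tuple /=.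
  by rewrite -subSn // subSS; apply; lia.
have prefixE (s t : H.-tuple bool) : n < H ->
    (iter (H - n.+1) half (2 ^ H + binval s) ==
     iter (H - n.+1) half (2 ^ H + binval t)) = (take n.+1 s == take n.+1 t).
  move=> nH; rewrite !node ?size_tuple //.
  rewrite !iter_half_rank ?size_tuple ?leq_subr // subKn // eqSS.
  by rewrite (inj_eq rank_inj).
have [nH|//] := boolP (n < H).
have surj u : u < 2 ^ H -> exists s : H.-tuple bool, binval s = u.
  move=> ltu; pose s := sigma (2 ^ H + u).-1.
  have rs : (rank s).+1 = 2 ^ H + u by rewrite rankK prednK // addn_gt0 pow.
  have sH : size s == H by rewrite size_eq_rank rs expnS; lia.
  exists (Tuple sH); have := rankS s; rewrite rs (eqP sH) /=; lia.
have ltb (s : H.-tuple bool) : binval s < 2 ^ H.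
  by have := binval_lt s; rewrite size_tuple.
apply/allP/forallP => [h s|h u].
  apply/forallP => t; have := h (binval s); rewrite mem_iota /= => /(_ (ltb s)).
  move=> /allP/(_ (binval t)); rewrite mem_iota /= => /(_ (ltb t)).
  by rewrite agreeE prefixE.
rewrite mem_iota /= => /surj[s <-]; apply/allP => v.
rewrite mem_iota /= => /surj[t <-].
by rewrite agreeE prefixE //; have /forallP := h s; exact.
Qed.

Lemma ce_test : ce (fun n => [set x : seq bool | exists H,
  (size x == (2 ^ H).*2 - 2) && separates n H (nth false x)]%classic).
Proof.
have [f hf] := mu_domain decides_test; exists f => n x.
rewrite -(hf [tuple n; rank x]).
by split=> -[H h]; exists H; [rewrite testP|rewrite -testP].
Qed.

Section martin_lof.
Context (R : realType).
Local Open Scope ring_scope.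
Local Open Scope classical_set_scope.

(** For positive exponents, (2/3)^2 = 4/9 is below 1/2, and n + 1 <= 2^n. *)
Lemma two_thirds_exp n : ((2 / 3) ^+ (2 ^ n)%N : R) <= 2 ^- n.
Proof.
case: n => [|n]; first by rewrite expr1 expr0 invr1; lra.
rewrite expnS exprM; have -> : ((2 / 3) ^+ 2 : R) = 4 / 9 by field.
rewrite -exprVn; apply: (@le_trans _ _ ((4 / 9) ^+ n.+1)).
  by apply: ler_wiXn2l; [lra|lra|exact: ltn_expl].
by apply: lerXn2r; rewrite ?nnegrE; lra.
Qed.

Lemma ml_test_separates :
  ml_test R (fun n => [set x | exists H, separates n H x]).
Proof.
split.
  exists (fun n => [set x : seq bool | exists H,
    (size x == ((2 ^ H).*2 - 2)%N) && separates n H (nth false x)]).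
    exact: ce_test.
  move=> n; apply/seteqP; split=> [x [H sep]|x [s [H /andP[/eqP ss sep]] sx]].
    (* This prefix contains every bit that the event at level [H] reads. *)
    pose s := mkseq x ((2 ^ H).*2 - 2).
    have ss : size s = ((2 ^ H).*2 - 2)%N by rewrite size_mkseq.
    exists s; last by rewrite /cylinder /= ss.
    exists H; rewrite ss eqxx /= -(@separates_depends n H x) // => i lt_i.
    by rewrite nth_mkseq.
  exists H; rewrite (@separates_depends n H x (nth false s)) // => i.
  by rewrite -ss => lt_i; rewrite -[in RHS]sx nth_mkseq.
move=> n; pose V H := [set x : nat -> bool | separates n H x].
have V_le H : measurable (V H : set cantor) /\
    (uniform_measure R (V H) <= (2 ^- n)%:E)%E.
  have [ltH|leH] := ltnP n H; last first.
    rewrite (_ : V H = set0).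
      by rewrite measure0 lee_fin invr_ge0 exprn_ge0.
    apply/seteqP; split=> // x /separatesP[]; by rewrite ltnNge leH.
  have imp x : separates n H x -> all_dead n (H - n.+1)%N [::] x.
    move=> sep; apply: separates_all_dead.
    by rewrite (_ : (_ + _).+1 = H) //; lia.
  have [mV hV] :=
    uniform_event_le (@separates_depends n H) imp
      (all_dead_prob R n (H - n.+1) [::]).
  by split=> //; apply: le_trans hV _; rewrite lee_fin two_thirds_exp.
rewrite (_ : [set x | _] = \bigcup_H V H); last first.
  by apply/seteqP; split=> x [H]; [exists H|move=> _; exists H].
have V_homo : nondecreasing_seq V.
  by apply/nondecreasing_seqP => H; apply/subsetPset => x; exact: separates_S.
(* Continuity from below: the events increase with [H], so the uniform bound passes to their
   union. *)
have cvgV := nondecreasing_cvg_mu (mu := uniform_measure R)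
  (fun H => (V_le H).1) (bigcup_measurable (fun H _ => (V_le H).1)) V_homo.
rewrite -(cvg_lim _ cvgV) //; apply: lime_le.
  by apply/cvg_ex; eexists; exact: cvgV.
by apply: nearW => H; exact: (V_le H).2.
Qed.

End martin_lof.

Theorem corollary5p4 (R : realType) (F : (nat -> bool) -> (nat -> bool))
  (hF : random_online R F) : ~ injective F.
Proof.
move: hF => [x rx ->] inj; apply: (rx _ (ml_test_separates R)) => n _ /=.
exact: injective_separates.
Qed.
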